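(* The following decision problem is undecidable: given a universal Horn sentence $\Phi$ over a finite relational signature $\tau$, decide whether the class $\mathrm{Mod}(\Phi)$ of all finite models of $\Phi$ has the joint embedding property. The problem remains undecidable even when every relation symbol in $\tau$ has arity at most two.
   Context: Formulas are first-order over a finite relational signature $\tau$ and do not use equality atoms (atomic formulas are only of the form $R(x_1,\dots,x_n)$ with $R\in\tau$). A universal sentence is Horn if its quantifier-free part is a conjunction of Horn clauses, i.e., disjunctions of atomic and negated atomic formulas with at most one positive disjunct. $\mathrm{Mod}(\Phi)$ denotes the class of all finite $\tau$-structures satisfying $\Phi$. A class $\mathcal{C}$ of $\tau$-structures has the joint embedding property (JEP) if for all $\mathfrak{B}_1,\mathfrak{B}_2\in\mathcal{C}$ there is $\mathfrak{C}\in\mathcal{C}$ with embeddings $\mathfrak{B}_1\hookrightarrow\mathfrak{C}$ and $\mathfrak{B}_2\hookrightarrow\mathfrak{C}$. *)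

(* Defs.v *)
From Stdlib Require List.
From mathcomp Require Import all_boot.
Unset Printing Implicit Defensive.

Inductive recf : Type :=
| RZero : recf
| RSucc : recf
| RProj : nat -> recf
| RComp : recf -> seq recf -> recf
| RRec  : recf -> recf -> recf
| RMu   : recf -> recf.

Inductive reval : recf -> seq nat -> nat -> Prop :=
| ev_zero v : reval RZero v 0
| ev_succ x v : reval RSucc (x :: v) x.+1
| ev_proj i v : reval (RProj i) v (nth 0 v i)
| ev_comp f gs v ys y :
    List.Forall2 (fun g y0 => reval g v y0) gs ys ->
    reval f ys y -> reval (RComp f gs) v y
| ev_rec0 f g v y : reval f v y -> reval (RRec f g) (0 :: v) y
| ev_recS f g n v r y :
    reval (RRec f g) (n :: v) r -> reval g (n :: r :: v) y ->
    reval (RRec f g) (n.+1 :: v) y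
| ev_mu f v n :
    reval f (n :: v) 0 ->
    (forall m, m < n -> exists k, reval f (m :: v) k.+1) ->
    reval (RMu f) v n.

(* Cantor pairing and the induced (computable, injective) codings. *)
Definition cpair (a b : nat) : nat := ((a + b) * (a + b).+1) %/ 2 + b.

Fixpoint enc_seq {T : Type} (e : T -> nat) (s : seq T) : nat :=
  if s is x :: s' then (cpair (e x) (enc_seq e s')).+1 else 0.

Definition enc_option {T : Type} (e : T -> nat) (o : option T) : nat :=
  if o is Some x then (e x).+1 else 0.

Definition undecidable {X : Type} (code : X -> nat)
    (valid : X -> Prop) (P : X -> Prop) : Prop :=
  ~ exists p : recf, forall x, valid x ->
      (P x /\ reval p [:: code x] 1) \/ (~ P x /\ reval p [:: code x] 0).

(* A finite relational signature: relation symbol i has arity nth 0 sg i,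
   for i < size sg. *)
Definition signature := seq nat.
(* Atomic formula R_i(x_{j_1}, ..., x_{j_k}) ; variables are nats.
   There are no equality atoms. *)
Definition atom := (nat * seq nat)%type.
(* Horn clause  ~A_1 \/ ... \/ ~A_m \/ [B]  (at most one positive literal):
   the list of negated atoms and the optional positive atom. *)
Definition horn_clause := (seq atom * option atom)%type.
(* Universal Horn sentence: universal closure of a conjunction of clauses. *)
Definition horn_sentence := seq horn_clause.

Definition wf_atom (sg : signature) (a : atom) : bool :=
  (a.1 < size sg) && (size a.2 == nth 0 sg a.1).
Definition wf_clause (sg : signature) (c : horn_clause) : bool :=
  all (wf_atom sg) c.1 && (if c.2 is Some a then wf_atom sg a else true).
Definition wf_sentence (sg : signature) (phi : horn_sentence) : bool :=
  all (wf_clause sg) phi.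

Definition enc_atom (a : atom) : nat := cpair a.1 (enc_seq id a.2).
Definition enc_clause (c : horn_clause) : nat :=
  cpair (enc_seq enc_atom c.1) (enc_option enc_atom c.2).
Definition enc_input (x : signature * horn_sentence) : nat :=
  cpair (enc_seq id x.1) (enc_seq enc_clause x.2).

(* Finite structures: domain {0,...,n} (nonempty, finite); symbol i is
   interpreted by the boolean predicate [rel i] on tuples (lists) of
   domain elements; only tuples of length (arity of i) are relevant. *)
Record fstructure := FStructure {
  fs_n : nat;
  fs_rel : nat -> seq 'I_fs_n.+1 -> bool
}.

Notation dom A := ('I_(fs_n A).+1).

Definition holds_atom (A : fstructure) (s : nat -> dom A) (a : atom) : bool :=
  fs_rel A a.1 (map s a.2).

Definition sat_clause (A : fstructure) (c : horn_clause) : Prop :=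
  forall s : nat -> dom A, all (holds_atom A s) c.1 ->
    if c.2 is Some a then holds_atom A s a else false.

Definition models (A : fstructure) (phi : horn_sentence) : Prop :=
  forall c, c \in phi -> sat_clause A c.

(* Embedding of tau-structures (no equality in the language, but
   embeddings are injective, as usual). *)
Definition embedding (sg : signature) (A B : fstructure) (f : dom A -> dom B)
  : Prop :=
  injective f /\
  forall i, i < size sg -> forall t : seq (dom A), size t = nth 0 sg i ->
    fs_rel A i t = fs_rel B i (map f t).

Definition JEP (sg : signature) (phi : horn_sentence) : Prop :=
  forall A B : fstructure, models A phi -> models B phi ->
    exists C : fstructure, models C phi /\
      (exists f, embedding sg A C f) /\ (exists g, embedding sg B C g).

Definition valid_input (x : signature * horn_sentence) : Prop :=
  wf_sentence x.1 x.2.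
Definition valid_input_arity2 (x : signature * horn_sentence) : Prop :=
  wf_sentence x.1 x.2 /\ all (fun k => k <= 2) x.1.
Definition JEP_problem (x : signature * horn_sentence) : Prop := JEP x.1 x.2.

(* Main.v *)
From Stdlib Require Import List.
Require Import Defs.
From HB Require Import structures.
From mathcomp Require Import all_boot.
From mathcomp Require Import boolp.
Set Implicit Arguments.
Unset Strict Implicit.

(** Evaluation of recursive functions is a system of inference rules over binary
trees; adding the rule "[num n.+1] if [F] is defined at [n]", derivability of
[num n.+1] expresses halting.  For such a rule system, elements of a structure
stand for trees, with relations Leaf, Fst, Snd and a relation E whose Horn clauses
make the tree denoted by an element unique.  Two further relations Val(z, x) and
Der(z, x), triggered only by a unary Q(z), say that x denotes a (derivable) tree,
and a last clause forbids Der(z, num n.+1).  Every clause is connected except for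
the variable z.  Hence the union of two models can be completed by
interpreting Val and Der truthfully across the two parts, unless [num n.+1] is
derivable; if it is, the trees of bounded height and a one-point structure with Q
have no joint embedding.

For undecidability, the only computation on codes that is needed is to prepend the
goal clause for n to a list of clauses of given code.  So a decider p gives d
such that d halts on m iff p accepts (goal clause for m) :: (clauses of code m), and
taking for m the code of the clauses that describe d itself is contradictory. *)

(** * Recursive functions *)

(** The direct fixpoint supplies induction hypotheses for the evaluations nested under [Forall2] and
    under the existential of [RMu]. *)
Lemma reval_nested_ind (P : recf -> seq nat -> nat -> Prop) :
  (forall v, P RZero v 0) ->
  (forall x v, P RSucc (x :: v) x.+1) ->
  (forall i v, P (RProj i) v (nth 0 v i)) ->
  (forall f gs v ys y, Forall2 (fun g y0 => P g v y0) gs ys -> P f ys y ->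
     P (RComp f gs) v y) ->
  (forall f g v y, P f v y -> P (RRec f g) (0 :: v) y) ->
  (forall f g n v r y, P (RRec f g) (n :: v) r -> P g (n :: r :: v) y ->
     P (RRec f g) (n.+1 :: v) y) ->
  (forall f v n, P f (n :: v) 0 ->
     (forall m, m < n -> exists k, P f (m :: v) k.+1) -> P (RMu f) v n) ->
  forall f v y, reval f v y -> P f v y.
Proof.
move=> Hz Hs Hp Hc Hr0 HrS Hmu; fix IH 4 => f v y [].
- exact: Hz.
- exact: Hs.
- exact: Hp.
- move=> {}f gs {}v ys {}y Hgs Hf; apply: Hc (IH _ _ _ Hf).
  by elim: Hgs => [|g y0 gs' ys' Hg _ IHgs]; constructor => //; exact: IH.
- by move=> {}f g {}v {}y /IH; exact: Hr0.
- by move=> {}f g n {}v r {}y /IH Hn /IH; exact: HrS.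
- move=> {}f {}v n /IH Hf Hm; apply: Hmu Hf _ => m /Hm [k Hk].
  by exists k; exact: IH.
Qed.

Lemma reval_det f v y y' : reval f v y -> reval f v y' -> y = y'.
Proof.
move=> H; elim/reval_nested_ind: H y' => {f v y}.
- by move=> v y' H; inversion H.
- by move=> x v y' H; inversion H.
- by move=> i v y' H; inversion H.
- move=> f gs v ys y IHgs IHf y' H; inversion H as [| | |f' gs' v' ys' z Hgs Hf| | |].
  subst; apply: IHf; suff -> : ys = ys' by [].
  elim: IHgs ys' Hgs {H Hf} => [|g y0 {}gs {}ys IHg _ IH] ys' H.
    by inversion H.
  by inversion H; subst; congr (_ :: _); [apply: IHg | apply: IH].
- by move=> f g v y IH y' H; inversion H; subst; apply: IH.
- move=> f g n v r y IHr IHg y' H.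
  inversion H as [| | | | |f' g' n' v' r' z Hr Hg|]; subst.
  by apply: IHg; rewrite (IHr _ Hr).
- move=> f v n IH0 IHm n' H; inversion H as [| | | | | |f' v' z H0 Hm]; subst.
  (* If the two results of the search differed, [f] would take both the value 0 and a positive value
     at the smaller one. *)
  case: (ltngtP n n') => // [/Hm [k /IH0]//|/IHm [k IHk]].
  by have := IHk _ H0.
Qed.

Lemma reval_comp1 f g v x y :
  reval g v x -> reval f [:: x] y -> reval (RComp f [:: g]) v y.
Proof. by move=> Hg; apply: ev_comp; repeat constructor. Qed.

Lemma reval_comp2 f g h v x1 x2 y :
  reval g v x1 -> reval h v x2 -> reval f [:: x1; x2] y ->
  reval (RComp f [:: g; h]) v y.
Proof. by move=> Hg Hh; apply: ev_comp; repeat constructor. Qed.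

Fixpoint rconst (k : nat) : recf :=
  if k is k'.+1 then RComp RSucc [:: rconst k'] else RZero.

Lemma rconstP k v : reval (rconst k) v k.
Proof.
elim: k => [|k IH] /=; first exact: ev_zero.
exact: reval_comp1 IH (ev_succ _ _).
Qed.

Definition rsucc (f : recf) : recf := RComp RSucc [:: f].

Lemma rsuccP f v x : reval f v x -> reval (rsucc f) v x.+1.
Proof. by move=> Hf; apply: reval_comp1 Hf (ev_succ _ _). Qed.

Definition radd : recf := RRec (RProj 0) (rsucc (RProj 1)).

Lemma raddP a b : reval radd [:: a; b] (a + b).
Proof.
elim: a => [|a IH]; first exact/ev_rec0/(ev_proj 0).
exact: ev_recS IH (rsuccP (ev_proj 1 _)).
Qed.

Definition triangle (n : nat) := (n * n.+1) %/ 2.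

(** This recurrence turns the halving in [cpair] into a primitive recursion, avoiding a recursive
    function for division. *)
Lemma triangleS n : triangle n.+1 = (n + triangle n).+1.
Proof.
rewrite /triangle (_ : n.+1 * n.+2 = n.+1 * 2 + n * n.+1) ?divnMDl ?addSn //.
by rewrite -[n.+2]addn2 mulnDr addnC [n.+1 * n]mulnC.
Qed.

Definition rtriangle : recf := RRec RZero (rsucc (RComp radd [:: RProj 0; RProj 1])).

Lemma rtriangleP n : reval rtriangle [:: n] (triangle n).
Proof.
elim: n => [|n IH]; first exact/ev_rec0/ev_zero.
rewrite triangleS; apply: ev_recS IH (rsuccP _).
exact: reval_comp2 (ev_proj 0 _) (ev_proj 1 _) (raddP _ _).
Qed.

Definition rpair (f g : recf) : recf :=
  RComp radd [:: RComp rtriangle [:: RComp radd [:: f; g]]; g].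

Lemma rpairP f g v a b :
  reval f v a -> reval g v b -> reval (rpair f g) v (cpair a b).
Proof.
move=> Hf Hg; apply: (reval_comp2 _ Hg (raddP _ _)).
by apply: reval_comp1 (rtriangleP _); apply: reval_comp2 Hf Hg (raddP _ _).
Qed.

Definition rcons_code (f g : recf) : recf := rsucc (rpair f g).

Lemma rcons_codeP (X : Type) (e : X -> nat) f g v x s :
  reval f v (e x) -> reval g v (enc_seq e s) ->
  reval (rcons_code f g) v (enc_seq e (x :: s)).
Proof. by move=> Hf Hg; apply/rsuccP/rpairP. Qed.

Fixpoint rseq (fs : seq recf) : recf :=
  if fs is f :: fs' then rcons_code f (rseq fs') else RZero.

Definition ratom (i : nat) (fs : seq recf) : recf := rpair (rconst i) (rseq fs).

Lemma ratomP i fs v xs :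
  Forall2 (fun f x => reval f v x) fs xs -> reval (ratom i fs) v (enc_atom (i, xs)).
Proof.
move=> Hfs; apply: rpairP (rconstP _ _) _.
elim: Hfs => [|f x {}fs {}xs Hf _ IH]; first exact: ev_zero.
exact: rcons_codeP.
Qed.

Definition rnot : recf := RRec (rconst 1) RZero.

Lemma rnot0 : reval rnot [:: 0] 1.
Proof. exact/ev_rec0/rconstP. Qed.

Lemma rnot1 : reval rnot [:: 1] 0.
Proof. exact: ev_recS rnot0 (ev_zero _). Qed.

(** * Derivations over trees *)

Inductive tree := Lf | Nd of tree & tree.
Inductive pat := PV of nat | PL | PN of pat & pat.

Fixpoint pat_of_tree (t : tree) : pat :=
  if t is Nd a b then PN (pat_of_tree a) (pat_of_tree b) else PL.

Fixpoint inst (s : nat -> tree) (p : pat) : tree :=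
  match p with
  | PV i => s i
  | PL => Lf
  | PN p q => Nd (inst s p) (inst s q)
  end.

Lemma inst_pat_of_tree s t : inst s (pat_of_tree t) = t.
Proof. by elim: t => //= a -> b ->. Qed.

(** Embedding patterns into generic trees makes them countable; the resulting [pickle] later names
    the variables of clauses. *)
Fixpoint gentree_of_pat (p : pat) : GenTree.tree nat :=
  match p with
  | PV i => GenTree.Leaf i
  | PL => GenTree.Node 0 [::]
  | PN p q => GenTree.Node 1 [:: gentree_of_pat p; gentree_of_pat q]
  end.

Fixpoint pat_of_gentree (g : GenTree.tree nat) : option pat :=
  match g with
  | GenTree.Leaf i => Some (PV i)
  | GenTree.Node 1 [:: g1; g2] =>
      obind (fun p => omap (PN p) (pat_of_gentree g2)) (pat_of_gentree g1)
  | _ => Some PL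
  end.

Lemma gentree_of_patK : pcancel gentree_of_pat pat_of_gentree.
Proof. by elim=> //= p -> q ->. Qed.

HB.instance Definition _ := Countable.copy pat (pcan_type gentree_of_patK).

Lemma pat_of_treeK : cancel pat_of_tree (inst (fun=> Lf)).
Proof. exact: inst_pat_of_tree. Qed.

HB.instance Definition _ := Countable.copy tree (can_type pat_of_treeK).

(** For a concrete list of rules or clauses, the right-hand side computes to a conjunction with one
    conjunct per entry. *)
Lemma forall_memP (X : eqType) (P : X -> Prop) s :
  (forall x, x \in s -> P x) <-> foldr (fun x => and (P x)) True s.
Proof.
split=> [|H x].
  elim: s => //= x s IH H; split; first exact/H/mem_head.
  by apply: IH => y Hy; apply: H; rewrite in_cons Hy orbT.
elim: s H => //= y s IH [Hy /IH Hs].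
by rewrite in_cons => /orP[/eqP->|].
Qed.

Definition rule := (seq pat * pat)%type.

Inductive derivable (R : seq rule) : tree -> Prop :=
| derivable_rule r s : r \in R ->
    (forall p, p \in r.1 -> derivable R (inst s p)) -> derivable R (inst s r.2).

(** * Evaluation of recursive functions as a rule system *)

Fixpoint num (n : nat) : tree := if n is n'.+1 then Nd Lf (num n') else Lf.

Fixpoint list_tree (s : seq tree) : tree :=
  if s is t :: s' then Nd t (list_tree s') else Lf.

Definition vec_tree (v : seq nat) : tree := list_tree (map num v).

Fixpoint recf_tree (f : recf) : tree :=
  match f with
  | RZero => Nd (num 0) Lf
  | RSucc => Nd (num 1) Lf
  | RProj i => Nd (num 2) (num i)
  | RComp f gs => Nd (num 3) (Nd (recf_tree f) (list_tree (map recf_tree gs)))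
  | RRec f g => Nd (num 4) (Nd (recf_tree f) (recf_tree g))
  | RMu f => Nd (num 5) (recf_tree f)
  end.

Definition recfs_tree (fs : seq recf) : tree := list_tree (map recf_tree fs).

(* The decoding functions are total, so that every rule is sound for arbitrary
   trees and no well-formedness invariant is needed. *)
Fixpoint tree_num (t : tree) : nat := if t is Nd _ b then (tree_num b).+1 else 0.

Fixpoint tree_vec (t : tree) : seq nat :=
  if t is Nd a b then tree_num a :: tree_vec b else [::].

Fixpoint tree_recf (t : tree) : recf :=
  if t is Nd tag body then
    match tree_num tag with
    | 0 => RZero
    | 1 => RSucc
    | 2 => RProj (tree_num body)
    | 3 => if body is Nd a b then RComp (tree_recf a) (tree_recfs b) else RZero
    | 4 => if body is Nd a b then RRec (tree_recf a) (tree_recf b) else RZero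
    | _ => RMu (tree_recf body)
    end
  else RZero
with tree_recfs (t : tree) : seq recf :=
  if t is Nd a b then tree_recf a :: tree_recfs b else [::].

Lemma numK : cancel num tree_num.
Proof. by elim=> //= n ->. Qed.

Lemma recf_treeK f : tree_recf (recf_tree f) = f.
Proof.
move: f; fix IH 1; case=> //=.
- by move=> i; rewrite numK.
- move=> f gs; rewrite IH; congr RComp.
  by elim: gs => //= g gs ->; rewrite IH.
- by move=> f g; rewrite !IH.
- by move=> f; rewrite IH.
Qed.

(* The first component of a judgement is a numeral tag.  With tag [0], the
   halting judgement for input [n] is the numeral [n.+1]. *)
Definition jeval (f v y : tree) := Nd (num 1) (Nd f (Nd v y)).

Definition pnum n := pat_of_tree (num n).
Definition pjudge k (f v y : pat) := PN (pnum k) (PN f (PN v y)).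
Definition pjeval := pjudge 1.
Definition pjevals := pjudge 2.
(* [pjpos f v n]: [f (m :: v)] is positive for all [m < n]. *)
Definition pjpos := pjudge 3.
Definition pzero := PN (pnum 0) PL.
Definition psucc := PN (pnum 1) PL.
Definition pproj i := PN (pnum 2) i.
Definition pcomp f gs := PN (pnum 3) (PN f gs).
Definition prec f g := PN (pnum 4) (PN f g).
Definition pmu f := PN (pnum 5) f.

(** Projections take three rules, since [nth] returns 0 on an exhausted vector. The auxiliary
    judgements [pjevals] and [pjpos] unfold the [Forall2] premise of composition and the bounded
    quantifier of minimisation. *)
Definition eval_rules : seq rule :=
  let f := PV 0 in let g := PV 1 in let v := PV 2 in let y := PV 3 in
  let n := PV 4 in let x := PV 5 in
  [:: ([::], pjeval pzero v PL);
      ([::], pjeval psucc (PN x v) (PN PL x));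
      ([::], pjeval (pproj n) PL PL);
      ([::], pjeval (pproj PL) (PN x v) x);
      ([:: pjeval (pproj n) v y], pjeval (pproj (PN PL n)) (PN x v) y);
      ([:: pjevals g v x; pjeval f x y], pjeval (pcomp f g) v y);
      ([::], pjevals PL v PL);
      ([:: pjeval f v x; pjevals g v y], pjevals (PN f g) v (PN x y));
      ([:: pjeval f v y], pjeval (prec f g) (PN PL v) y);
      ([:: pjeval (prec f g) (PN n v) x; pjeval g (PN n (PN x v)) y],
        pjeval (prec f g) (PN (PN PL n) v) y);
      ([:: pjeval f (PN n v) PL; pjpos f v n], pjeval (pmu f) v n);
      ([::], pjpos f v PL);
      ([:: pjpos f v n; pjeval f (PN n v) (PN PL x)], pjpos f v (PN PL n))].

Definition halt_rule (f : recf) : rule :=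
  ([:: pjeval (pat_of_tree (recf_tree f)) (PN (PV 0) PL) (PV 1)], PN PL (PV 0)).

Definition rules (f : recf) : seq rule := halt_rule f :: eval_rules.

(** The invariant of derivations, read through the total decoding functions; trees that are not
    judgements impose nothing. *)
Definition judgement_holds (F : recf) (t : tree) : Prop :=
  if t is Nd tag body then
    match tree_num tag, body with
    | 0, n => exists y, reval F [:: tree_num n] y
    | 1, Nd f (Nd v y) => reval (tree_recf f) (tree_vec v) (tree_num y)
    | 2, Nd fs (Nd v ys) =>
        Forall2 (fun f y => reval f (tree_vec v) y) (tree_recfs fs) (tree_vec ys)
    | 3, Nd f (Nd v n) => forall m, m < tree_num n ->
        exists k, reval (tree_recf f) (m :: tree_vec v) k.+1
    | _, _ => True
    end
  else True.

Lemma derivable_sound F t : derivable (rules F) t -> judgement_holds F t.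
Proof.
elim=> {t} r s Hr _ IH; move: r Hr s IH; apply/forall_memP.
do !split; move=> s /forall_memP.
- rewrite /= inst_pat_of_tree recf_treeK => -[H _]; by exists (tree_num (s 1)).
- move=> _; exact: ev_zero.
- move=> _; exact: ev_succ.
- by move=> _; rewrite /= -[X in reval _ _ X](nth_nil 0 (tree_num (s 4))); apply: ev_proj.
- move=> _; exact: (ev_proj 0).
- rewrite /= => -[H _]; inversion H; subst.
  exact: (ev_proj (tree_num (s 4)).+1 (_ :: _)).
- by rewrite /= => -[H1 [H2 _]]; apply: ev_comp H1 H2.
- by constructor.
- by rewrite /= => -[H1 [H2 _]]; constructor.
- by rewrite /= => -[H _]; apply: ev_rec0.
- by rewrite /= => -[H1 [H2 _]]; apply: ev_recS H1 H2.
- by rewrite /= => -[H1 [H2 _]]; apply: ev_mu H1 H2.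
- by [].
- rewrite /= => -[H1 [H2 _]] m.
  rewrite ltnS leq_eqVlt => /orP[/eqP->|/H1//].
  by exists (tree_num (s 5)).
Qed.

(** [i] is a position in [rules], the halting rule being 0; [vs] gives the values of f, g, v, y, n,
    x in the order of [eval_rules], with [Lf] for those omitted. *)
Ltac derive_with i vs :=
  apply: (@derivable_rule _ (nth (halt_rule RZero) (rules _) i) (nth Lf vs));
  [exact: mem_nth | apply/forall_memP; rewrite /=; do !split=> //].

Lemma reval_derivable F f v y :
  reval f v y -> derivable (rules F) (jeval (recf_tree f) (vec_tree v) (num y)).
Proof.
elim/reval_nested_ind=> {f v y}.
- by move=> v; derive_with 1 [:: Lf; Lf; vec_tree v].
- by move=> x v; derive_with 2 [:: Lf; Lf; vec_tree v; Lf; Lf; num x].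
- elim=> [|i IH] [|x v].
  + by derive_with 3 (Nil tree).
  + by derive_with 4 [:: Lf; Lf; vec_tree v; Lf; Lf; num x].
  + by derive_with 3 [:: Lf; Lf; Lf; Lf; num i.+1].
  + derive_with 5 [:: Lf; Lf; vec_tree v; num (nth 0 v i); num i; num x].
    exact: IH.
- move=> f gs v ys y Hgs Hf.
  derive_with 6 [:: recf_tree f; recfs_tree gs; vec_tree v; num y; Lf; vec_tree ys].
  elim: Hgs {Hf} => [|g z {}gs {}ys Hg _ IH].
    by derive_with 7 [:: Lf; Lf; vec_tree v].
  by derive_with 8 [:: recf_tree g; recfs_tree gs; vec_tree v; vec_tree ys; Lf; num z].
- move=> f g v y Hf.
  by derive_with 9 [:: recf_tree f; recf_tree g; vec_tree v; num y].
- move=> f g n v r y Hr Hg.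
  by derive_with 10 [:: recf_tree f; recf_tree g; vec_tree v; num y; num n; num r].
- move=> f v n Hf Hm.
  derive_with 11 [:: recf_tree f; Lf; vec_tree v; Lf; num n].
  (* Positivity below [n] is derived one argument at a time. *)
  elim: n Hm {Hf} => [|n IH] Hm.
    by derive_with 12 [:: recf_tree f; Lf; vec_tree v].
  have [k Hk] := Hm n (ltnSn n).
  derive_with 13 [:: recf_tree f; Lf; vec_tree v; Lf; num n; num k].
  by apply: IH => m Hmn; apply: Hm; apply: ltnW.
Qed.

Lemma derivable_haltP F n :
  derivable (rules F) (num n.+1) <-> exists y, reval F [:: n] y.
Proof.
split=> [/derivable_sound /=|[y Hy]]; first by rewrite numK.
apply: (@derivable_rule _ (halt_rule F) (nth Lf [:: num n; num y])) (mem_head _ _) _.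
apply/forall_memP; split=> //=; rewrite inst_pat_of_tree; exact: reval_derivable Hy.
Qed.

(** * The Horn sentence and the joint structure *)

Definition aLeaf x : atom := (0, [:: x]).
Definition aFst x y : atom := (1, [:: x; y]).
Definition aSnd x y : atom := (2, [:: x; y]).
Definition aEq x y : atom := (3, [:: x; y]).
Definition aQ z : atom := (4, [:: z]).
Definition aVal z x : atom := (5, [:: z; x]).
Definition aDer z x : atom := (6, [:: z; x]).

Definition tree_sg : signature := [:: 1; 2; 2; 2; 1; 2; 2].

(** In place of equality, [E] starts on the diagonal and passes to first and second components; the
    last two clauses keep it from relating a leaf to a node. *)
Definition eq_clauses : horn_sentence := [::
  ([::], Some (aEq 0 0));
  ([:: aEq 0 1; aFst 0 2; aFst 1 3], Some (aEq 2 3));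
  ([:: aEq 0 1; aSnd 0 2; aSnd 1 3], Some (aEq 2 3));
  ([:: aEq 0 1; aLeaf 0; aFst 1 2], None);
  ([:: aEq 0 1; aFst 0 2; aLeaf 1], None)].

Definition val_clauses : horn_sentence := [::
  ([:: aQ 0; aLeaf 1], Some (aVal 0 1));
  ([:: aFst 1 2; aSnd 1 3; aVal 0 2; aVal 0 3], Some (aVal 0 1))].

Fixpoint subpats (p : pat) : seq pat :=
  p :: if p is PN a b then subpats a ++ subpats b else [::].

(** Variable 0 is the guard z. Requiring [Val] at pattern variables too ensures that, when z lies in
    the other part, each of them denotes a tree to substitute. *)
Fixpoint pat_atoms (nm : pat -> nat) (p : pat) : seq atom :=
  aVal 0 (nm p) ::
  match p with
  | PV _ => [::]
  | PL => [:: aLeaf (nm p)]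
  | PN a b => aFst (nm p) (nm a) :: aSnd (nm p) (nm b) ::
      pat_atoms nm a ++ pat_atoms nm b
  end.

Definition pat_clause nm (ps : seq pat) (root : pat) (h : option pat) : horn_clause :=
  ([seq aDer 0 (nm p) | p <- ps] ++ pat_atoms nm root, omap (fun p => aDer 0 (nm p)) h).

(* Naming the variable of a node by the code of its pattern avoids fresh names. *)
Definition pat_name (p : pat) : nat := (pickle p).+1.

(** Gathering premises and conclusion in one pattern connects all variables other than 0 through
    [Fst] and [Snd]. *)
Definition rule_root (r : rule) : pat := foldr PN r.2 r.1.

Definition rule_clause (r : rule) : horn_clause :=
  pat_clause pat_name r.1 (rule_root r) (Some r.2).

Fixpoint pat_height (p : pat) : nat :=
  if p is PN a b then (maxn (pat_height a) (pat_height b)).+1 else 0.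

(* Unlike [pat_name], this gives the numerals small names that are easy to compute. *)
Definition num_name (p : pat) : nat := (pat_height p).+1.

Definition goal_clause (n : nat) : horn_clause :=
  pat_clause num_name [:: pnum n] (pnum n) None.

Definition rule_sentence (R : seq rule) : horn_sentence :=
  eq_clauses ++ val_clauses ++ map rule_clause R.

Lemma wf_pat_atoms nm p : all (wf_atom tree_sg) (pat_atoms nm p).
Proof. by elim: p => //= a IHa b IHb; rewrite all_cat IHa IHb. Qed.

Lemma wf_pat_clause nm ps root h : wf_clause tree_sg (pat_clause nm ps root h).
Proof.
rewrite /wf_clause /= all_cat all_map wf_pat_atoms andbT.
by rewrite (@eq_all _ _ predT) ?all_predT //; case: h.
Qed.

Lemma wf_goal_rules R n : wf_sentence tree_sg (goal_clause n :: rule_sentence R).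
Proof.
rewrite /wf_sentence /rule_sentence /= wf_pat_clause /= all_map.
by apply/allP=> r _; exact: wf_pat_clause.
Qed.

(** * Trees denoted by elements, and their uniqueness *)

Inductive value (A : fstructure) : dom A -> tree -> Prop :=
| value_leaf x : fs_rel A 0 [:: x] -> value x Lf
| value_node x a b s t : fs_rel A 1 [:: x; a] -> fs_rel A 2 [:: x; b] ->
    value a s -> value b t -> value x (Nd s t).

Section ValueUnique.
Context (A : fstructure) (HA : models A eq_clauses).

Let eq_clauseP i (s : nat -> dom A) : i < 5 ->
  let c := nth ([::], None) eq_clauses i in
  all (holds_atom A s) c.1 -> if c.2 is Some a then holds_atom A s a else false.
Proof. by move=> Hi c; apply: HA; apply: mem_nth. Qed.

Lemma value_refl x : fs_rel A 3 [:: x; x].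
Proof. exact: (@eq_clauseP 0 (fun=> x)). Qed.

(** Uniqueness is proved for [E]-related elements because the components of one element are only
    known to be [E]-related. *)
Lemma value_eq (x : dom A) s y t : value x s -> fs_rel A 3 [:: x; y] -> value y t -> s = t.
Proof.
move=> Hx; elim: Hx y t => {x s} [x Lx|x a b s1 s2 Fx Sx _ IH1 _ IH2] y t E Hy;
  case: Hy E => {y t} [y Ly|y c d t1 t2 Fy Sy Hc Hd] E //.
- have := @eq_clauseP 3 (nth x [:: x; y; c]) isT.
  by rewrite /= /holds_atom /= E Lx Fy; move/(_ isT).
- have := @eq_clauseP 4 (nth x [:: x; y; a]) isT.
  by rewrite /= /holds_atom /= E Fx Ly; move/(_ isT).
- have := @eq_clauseP 1 (nth x [:: x; y; a; c]) isT.
  rewrite /= /holds_atom /= E Fx Fy; move/(_ isT) => E1.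
  have := @eq_clauseP 2 (nth x [:: x; y; b; d]) isT.
  rewrite /= /holds_atom /= E Sx Sy; move/(_ isT) => E2.
  by rewrite (IH1 _ _ E1 Hc) (IH2 _ _ E2 Hd).
Qed.

Lemma value_fun (x : dom A) s t : value x s -> value x t -> s = t.
Proof. by move=> Hs; apply: value_eq Hs (value_refl x). Qed.

End ValueUnique.

Definition clause_vars (c : horn_clause) : seq nat :=
  flatten (map snd c.1) ++ if c.2 is Some a then a.2 else [::].

(** The joint structure makes every relation false on the empty tuple, so truth is transferred only
    for atoms with arguments. *)
Definition nonnullary_atom (a : atom) := a.2 != [::].
Definition nonnullary (c : horn_clause) :=
  all nonnullary_atom c.1 && if c.2 is Some a then nonnullary_atom a else true.

Lemma subpats_refl p : p \in subpats p.
Proof. by case: p => *; rewrite inE eqxx. Qed.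

Lemma subpats_atoms nm p q : q \in subpats p ->
  {subset pat_atoms nm q <= pat_atoms nm p}.
Proof.
elim: p q => [i||a IHa b IHb] q //=; rewrite in_cons => /predU1P[->//|] //.
rewrite mem_cat => /orP[/IHa H|/IHb H] x /H Hx; rewrite !inE mem_cat Hx ?orbT //.
Qed.

Lemma subpats_trans p q r : q \in subpats p -> r \in subpats q -> r \in subpats p.
Proof.
elim: p q => [i||a IHa b IHb] q /=; rewrite in_cons => /predU1P[->//|] //.
by rewrite inE !mem_cat => /orP[/IHa H|/IHb H] /H ->; rewrite !orbT.
Qed.

Lemma pat_atoms_vars nm p :
  {subset flatten (map snd (pat_atoms nm p)) <= 0 :: map nm (subpats p)}.
Proof.
elim: p => [i||c IHc d IHd] x /=; first by rewrite !inE.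
  by rewrite !inE orbb.
rewrite !map_cat flatten_cat !inE !mem_cat.
have Hr p : nm p \in map nm (subpats p) by apply/map_f/subpats_refl.
move=> H; have {H} : [|| x == 0, x == nm (PN c d), x \in 0 :: map nm (subpats c) |
    x \in 0 :: map nm (subpats d)].
  case/orP: H => [->//|/orP[->|]]; first by rewrite orbT.
  case/orP=> [->|/orP[/eqP->|]]; rewrite ?orbT //; first by rewrite inE Hr !orbT.
  case/orP=> [->|/orP[/eqP->|]]; rewrite ?orbT //; first by rewrite !inE Hr !orbT.
  by case/orP=> [/IHc->|/IHd->]; rewrite ?orbT.
by rewrite !inE => /or4P[->|->|/orP[->|->]|/orP[->|->]]; rewrite ?orbT.
Qed.

Lemma pat_clause_vars nm ps root h :
  {subset ps <= subpats root} -> (if h is Some p then p \in subpats root else true) ->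
  {subset clause_vars (pat_clause nm ps root h) <= 0 :: map nm (subpats root)}.
Proof.
move=> Hps Hh x; rewrite mem_cat map_cat flatten_cat mem_cat -orbA => /or3P[].
- case/flattenP=> l /mapP[a /mapP[p Hp ->] ->]; rewrite !inE => /orP[->//|/eqP->].
  by rewrite map_f ?orbT ?Hps.
- exact: pat_atoms_vars.
by case: h Hh => //= p Hp; rewrite !inE => /orP[->//|/eqP->]; rewrite map_f ?orbT.
Qed.

Lemma pat_clause_nonnullary nm ps root h : nonnullary (pat_clause nm ps root h).
Proof.
rewrite /nonnullary /= all_cat all_map (@eq_all _ _ predT) ?all_predT //=.
have -> : all nonnullary_atom (pat_atoms nm root).
  by elim: root => //= a IHa b IHb; rewrite all_cat IHa IHb.
by case: h.
Qed.

(** * The joint structure of two models *)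

Section Join.
Context (R : seq rule) (A B : fstructure).

Let sides b := if b then A else B.
Let jdom := 'I_((fs_n A).+1 + (fs_n B).+1).

Let side (x : jdom) : bool := if split x is inl _ then true else false.
(** Only meaningful on elements of side [b]; the others go to the dummy value [ord0]. *)
Let part b : jdom -> dom (sides b) :=
  if b return jdom -> dom (sides b)
  then fun x => if split x is inl a then a else ord0
  else fun x => if split x is inr a then a else ord0.

Let crossing b i (x : dom (sides b)) : Prop :=
  match i with
  | 5 => exists t, value x t
  | 6 => exists2 t, value x t & derivable R t
  | _ => False
  end.

Let join_rel i (t : seq jdom) : bool :=
  if t isn't x :: t' then false else
  if all (fun y => side y == side x) t'
  then fs_rel (sides (side x)) i (map (part (side x)) t)
  else if t' is [:: y]
  then fs_rel (sides (side x)) 4 [:: part (side x) x] && `[< crossing i (part (side y) y) >]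
  else false.

Definition join : fstructure := @FStructure (fs_n A + (fs_n B).+1) join_rel.

Let inj b : dom (sides b) -> jdom :=
  if b return dom (sides b) -> jdom then @lshift _ _ else @rshift _ _.

Let side_inj b x : side (@inj b x) = b.
Proof. by case: b x => x; rewrite /side /inj ?(unsplitK (inl x)) ?(unsplitK (inr x)). Qed.

Let part_inj b x : part b (@inj b x) = x.
Proof. by case: b x => x; rewrite /part /inj ?(unsplitK (inl x)) ?(unsplitK (inr x)). Qed.

Let join_same b i x t : all (fun y => side y == b) (x :: t) ->
  join_rel i (x :: t) = fs_rel (sides b) i (map (part b) (x :: t)).
Proof. by move=> /= /andP[/eqP <-] H; rewrite H. Qed.

Let join_cross b i x y : side y = b -> side x != b -> join_rel i [:: x; y] =
  fs_rel (sides (side x)) 4 [:: part (side x) x] && `[< crossing i (part b y) >].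
Proof. by move=> <- H; rewrite /= andbT eq_sym (negbTE H). Qed.

Let join_side i x y : i < 5 -> join_rel i [:: x; y] -> side x = side y.
Proof.
move=> Hi; case: (eqVneq (side x) (side y)) => // H.
rewrite (join_cross _ (erefl _)) // => /andP[_ /asboolP].
by case: i Hi => [|[|[|[|[|]]]]].
Qed.

Lemma join_embedding b : (forall i, i < size tree_sg -> nth 0 tree_sg i > 0) ->
  exists f, embedding tree_sg (sides b) join f.
Proof.
move=> Hpos; exists (@inj b); split; first exact: (can_inj (@part_inj b)).
move=> i /Hpos Hi [|x t] /= Ht; first by rewrite -Ht in Hi.
rewrite -[RHS]/(join_rel i (map (@inj b) (x :: t))) (@join_same b).
  by rewrite /= part_inj -map_comp (eq_map (@part_inj b)) map_id.
by rewrite /= side_inj eqxx all_map; apply/allP=> y _ /=; rewrite side_inj.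
Qed.

Context (HA : models A (eq_clauses ++ val_clauses)).
Context (HB : models B (eq_clauses ++ val_clauses)).

Let sidesP b : models (sides b) (eq_clauses ++ val_clauses).
Proof. by case: b. Qed.

(** On elements of a single part, atoms have the same truth value in [join] as in that part, so the
    clause is inherited. *)
Let join_mono b (c : horn_clause) (s : nat -> jdom) :
  sat_clause (sides b) c -> nonnullary c ->
  (forall x, x \in clause_vars c -> side (s x) = b) ->
  all (@holds_atom join s) c.1 ->
  if c.2 is Some a then @holds_atom join s a else false.
Proof.
case: c => body h /= Hc /andP[/= Hb Hh] Hs.
have same a : nonnullary_atom a -> {subset a.2 <= clause_vars (body, h)} ->
    @holds_atom join s a = @holds_atom (sides b) (part b \o s) a.
  case: a => i [|x t] //= _ Hsub.
  have Ht : all (fun y => side y == b) (map s (x :: t)).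
    by rewrite all_map; apply/allP=> y /Hsub /Hs /= ->.
  by rewrite -[LHS]/(join_rel i (map s (x :: t))) (@join_same b _ _ _ Ht) /holds_atom /= -map_comp.
move=> /allP Hbody.
have : all (@holds_atom (sides b) (part b \o s)) body.
  apply/allP=> a Ha; rewrite -same ?(allP Hb) ?Hbody // => x Hx.
  by rewrite mem_cat; apply/orP; left; apply/flattenP; exists a.2; rewrite ?map_f.
move/(Hc (part b \o s)); case: h Hh same {Hc Hs} => [a|] Hh same // H.
refine (eq_ind_r is_true H (same a Hh _)) => x Hx.
by rewrite mem_cat /= Hx orbT.
Qed.

Let join_connected c : c \in eq_clauses ++ val_clauses -> nonnullary c ->
  (forall s, all (@holds_atom join s) c.1 ->
     forall x, x \in clause_vars c -> side (s x) = side (s (head 0 (clause_vars c)))) ->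
  sat_clause join c.
Proof.
move=> Hc Hp Hs s Hbody.
exact: (join_mono (@sidesP _ _ Hc) Hp (Hs s Hbody) Hbody).
Qed.

(** Symbols below 5 never hold across the parts, so true premises force all variables of such a
    clause to one side. *)
Lemma join_eq_clauses : models join eq_clauses.
Proof.
move=> c Hc; apply: join_connected; first by rewrite mem_cat Hc.
  by apply: (allP (isT : all nonnullary eq_clauses)).
move: c Hc; apply/forall_memP; do !split; move=> s H; apply/forall_memP.
- by do !split.
- case/andP: H => /(@join_side 3 _ _ isT) H1 /andP[/(@join_side 1 _ _ isT) H2].
  by case/andP=> /(@join_side 1 _ _ isT) H3 _; do !split; rewrite /=; congruence.
- case/andP: H => /(@join_side 3 _ _ isT) H1 /andP[/(@join_side 2 _ _ isT) H2].
  by case/andP=> /(@join_side 2 _ _ isT) H3 _; do !split; rewrite /=; congruence.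
- case/andP: H => /(@join_side 3 _ _ isT) H1 /andP[_].
  by case/andP=> /(@join_side 1 _ _ isT) H3 _; do !split; rewrite /=; congruence.
- case/andP: H => /(@join_side 3 _ _ isT) H1 /andP[/(@join_side 1 _ _ isT) H2 _].
  by do !split; rewrite /=; congruence.
Qed.

(* In the remaining clauses all variables but [0] lie on one side. *)
Let join_guarded c :
  (forall b, sat_clause (sides b) c) -> nonnullary c ->
  (forall s, all (@holds_atom join s) c.1 -> exists b,
     (forall x, x \in clause_vars c -> x != 0 -> side (s x) = b) /\
     (side (s 0) != b -> if c.2 is Some a then @holds_atom join s a else false)) ->
  sat_clause join c.
Proof.
move=> Hc Hp Hs s Hbody; have [b [Hb H0]] := Hs s Hbody.
case: (eqVneq (side (s 0)) b) => [E|/H0//].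
apply: (join_mono (Hc b) Hp _ Hbody) => x Hx.
by case: (eqVneq x 0) => [->//|]; apply: Hb.
Qed.

Lemma join_val_clauses : models join val_clauses.
Proof.
move=> c Hc; apply: join_guarded.
- by move=> b; apply: sidesP; rewrite mem_cat Hc orbT.
- by apply: (allP (isT : all nonnullary val_clauses)).
move: c Hc; apply/forall_memP; do !split; move=> s.
- case/andP=> HQ /andP[HL _]; exists (side (s 1)).
  split; first by apply/forall_memP; do !split.
  move=> H; rewrite -[is_true _]/(is_true (join_rel 5 [:: s 0; s 1])).
  rewrite (join_cross _ (erefl _) H); apply/andP; split; first by move: HQ.
  by apply/asboolP; exists Lf; apply: value_leaf.
- case/andP=> HF /andP[HS /andP[Ha /andP[Hb _]]].
  have EF := @join_side 1 _ _ isT HF; have ES := @join_side 2 _ _ isT HS.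
  exists (side (s 1)); split; first by apply/forall_memP; do !split=> //=; congruence.
  move=> H; rewrite -[is_true _]/(is_true (join_rel 5 [:: s 0; s 1])).
  rewrite (join_cross _ (erefl _) H); apply/andP.
  (* Both [Val] premises cross the parts as well, so they yield [Q] at z and a tree for each
     component. *)
  have H5 x : side x = side (s 1) -> join_rel 5 [:: s 0; x] ->
    fs_rel (sides (side (s 0))) 4 [:: part (side (s 0)) (s 0)] /\
    exists t, value (part (side (s 1)) x) t.
    by move=> Hx; rewrite (join_cross _ Hx H) => /andP[? /asboolP].
  have [HQ [t Ht]] := H5 _ (esym EF) Ha; have [_ [u Hu]] := H5 _ (esym ES) Hb.
  split=> //; apply/asboolP; exists (Nd t u); apply: value_node Ht Hu.
    move: HF; rewrite -[is_true _]/(is_true (join_rel 1 [:: s 1; s 2])).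
    by rewrite (@join_same (side (s 1))) //= EF eqxx.
  move: HS; rewrite -[is_true _]/(is_true (join_rel 2 [:: s 1; s 3])).
  by rewrite (@join_same (side (s 1))) //= ES eqxx.
Qed.

Let pat_side nm p s q : all (@holds_atom join s) (pat_atoms nm p) ->
  q \in subpats p -> side (s (nm q)) = side (s (nm p)).
Proof.
elim: p q => [i||a IHa b IHb] q /= H; rewrite in_cons => /predU1P[->//|] //.
case/and4P: H => _ Ha Hb; rewrite all_cat => /andP[HA' HB'].
have Ea := @join_side 1 _ _ isT Ha; have Eb := @join_side 2 _ _ isT Hb.
by rewrite mem_cat => /orP[/(IHa _ HA')|/(IHb _ HB')] ->.
Qed.

Let pat_value nm p s b t :
  (forall q, q \in subpats p -> side (s (nm q)) = b) ->
  all (@holds_atom join s) (pat_atoms nm p) ->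
  (forall i, PV i \in subpats p -> value (part b (s (nm (PV i)))) (t i)) ->
  value (part b (s (nm p))) (inst t p).
Proof.
elim: p => [i||c IHc d IHd] Hs H Ht.
- by apply: Ht; rewrite inE eqxx.
- case/and3P: H => _ H _; apply: value_leaf; move: H.
  rewrite -[is_true _]/(is_true (join_rel 0 [:: s (nm PL)])).
  by rewrite (@join_same b) //= Hs ?subpats_refl // eqxx.
have Hc q : q \in subpats c -> q \in subpats (PN c d).
  by rewrite /= inE mem_cat => ->; rewrite orbT.
have Hd q : q \in subpats d -> q \in subpats (PN c d).
  by rewrite /= inE mem_cat => ->; rewrite !orbT.
have Es q : q \in subpats (PN c d) -> side (s (nm q)) == b by move=> /Hs->.
case/and4P: H => _ HF HS H.
have /andP[HA' HB'] : all (@holds_atom join s) (pat_atoms nm c) &&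
    all (@holds_atom join s) (pat_atoms nm d) by rewrite -all_cat.
apply: value_node (IHc _ HA' _) (IHd _ HB' _).
- move: HF; rewrite -[is_true _]/(is_true (join_rel 1 [:: s (nm (PN c d)); s (nm c)])).
  by rewrite (@join_same b) //= !(Es _ (subpats_refl _), Es _ (Hc _ (subpats_refl _))).
- move: HS; rewrite -[is_true _]/(is_true (join_rel 2 [:: s (nm (PN c d)); s (nm d)])).
  by rewrite (@join_same b) //= !(Es _ (subpats_refl _), Es _ (Hd _ (subpats_refl _))).
- by move=> q /Hc; apply: Hs.
- by move=> i /Hc; apply: Ht.
- by move=> q /Hd; apply: Hs.
- by move=> i /Hd; apply: Ht.
Qed.

(** If z lies opposite the root, the crossing [Val] atoms provide a substitution, the crossing [Der]
    atoms make the premises derivable under it, and [Hsound] gives the head, or a contradiction when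
    there is none. *)
Lemma join_pat_clause nm ps root h :
  {subset ps <= subpats root} -> (if h is Some p then p \in subpats root else true) ->
  (forall t, (forall p, p \in ps -> derivable R (inst t p)) ->
     if h is Some p then derivable R (inst t p) else False) ->
  models A [:: pat_clause nm ps root h] -> models B [:: pat_clause nm ps root h] ->
  models join [:: pat_clause nm ps root h].
Proof.
move=> Hps Hh Hsound HmA HmB c; rewrite inE => /eqP {c}->; apply: join_guarded.
- by case; [apply: HmA | apply: HmB]; rewrite inE.
- exact: pat_clause_nonnullary.
move=> s; rewrite /= all_cat all_map => /andP[Hders Hatoms]; set b := side (s (nm root)).
have Hside q : q \in subpats root -> side (s (nm q)) = b.
  by move=> Hq; exact: (pat_side Hatoms Hq).
exists b; split=> [x /(pat_clause_vars Hps Hh)|H].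
  by rewrite inE => /predU1P[->//|/mapP[q Hq ->] _]; apply: Hside.
have HD q : q \in subpats root -> fs_rel (sides (side (s 0))) 4 [:: part (side (s 0)) (s 0)] /\
    exists t, value (part b (s (nm q))) t.
  move=> Hq; have : @holds_atom join s (aVal 0 (nm q)).
    by apply: (allP Hatoms); apply: (subpats_atoms Hq); case: (q) => *; rewrite inE eqxx.
  rewrite -[is_true _]/(is_true (join_rel 5 [:: s 0; s (nm q)])).
  by rewrite (join_cross _ (Hside _ Hq) H) => /andP[? /asboolP].
(* A substitution read off the values of the pattern variables; indices not occurring in [root] get
   [Lf]. *)
have /choice[t Ht] : forall i, exists u,
    PV i \in subpats root -> value (part b (s (nm (PV i)))) u.
  move=> i; case: (boolP (PV i \in subpats root)) => [/HD[_ [u Hu]]|_]; last by exists Lf.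
  by exists u.
have Hval q : q \in subpats root -> value (part b (s (nm q))) (inst t q).
  move=> Hq; apply: (@pat_value nm q s b t).
  - by move=> q' Hq'; apply: Hside; move: Hq'; apply: subpats_trans.
  - by apply/allP=> a Ha; apply: (allP Hatoms); apply: (subpats_atoms Hq).
  - by move=> i Hi; apply: Ht; move: Hi; apply: subpats_trans.
have Hder : forall p, p \in ps -> derivable R (inst t p).
  move=> p Hp; have Hp' := Hps _ Hp; have := allP Hders _ Hp; rewrite /=.
  rewrite -[is_true _]/(is_true (join_rel 6 [:: s 0; s (nm p)])).
  rewrite (join_cross _ (Hside _ Hp') H) => /andP[_ /asboolP[u Hu]].
  (* The crossing [Der] atom gives some derivable tree; uniqueness of values identifies it with the
     instance of [p]. *)
  suff -> : inst t p = u by [].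
  have HmS : models (sides b) eq_clauses.
    by move=> c Hc; apply: sidesP; rewrite mem_cat Hc.
  exact: (value_fun HmS (Hval _ Hp') Hu).
have := Hsound _ Hder; case: h Hh {Hsound HmA HmB} => // p Hp Hdp.
rewrite -[is_true _]/(is_true (join_rel 6 [:: s 0; s (nm p)])).
rewrite (join_cross _ (Hside _ Hp) H); have [-> _] := HD _ Hp.
by apply/asboolP; exists (inst t p); first exact: Hval.
Qed.
End Join.

Lemma models_sub A phi psi : {subset psi <= phi} -> models A phi -> models A psi.
Proof. by move=> Hsub HA c /Hsub; apply: HA. Qed.

Lemma rule_root_prems (r : rule) : {subset r.1 <= subpats (rule_root r)}.
Proof.
case: r => ps c; rewrite /rule_root /=; elim: ps => //= p ps IH q.
by rewrite !in_cons mem_cat => /predU1P[->|/IH->]; rewrite ?subpats_refl ?orbT.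
Qed.

Lemma rule_root_concl (r : rule) : r.2 \in subpats (rule_root r).
Proof.
case: r => ps c; rewrite /rule_root /=; elim: ps => [|p ps IH]; first exact: subpats_refl.
by rewrite /= in_cons mem_cat IH !orbT.
Qed.

Lemma JEP_of_not_derivable R n :
  ~ derivable R (num n) -> JEP tree_sg (goal_clause n :: rule_sentence R).
Proof.
move=> Hn A B HA HB; exists (join R A B).
have sub_ev : {subset eq_clauses ++ val_clauses <= goal_clause n :: rule_sentence R}.
  by move=> c Hc; rewrite in_cons /rule_sentence catA mem_cat Hc orbT.
have sub_pat c : c \in goal_clause n :: map rule_clause R ->
    {subset [:: c] <= goal_clause n :: rule_sentence R}.
  by move=> Hc c'; rewrite inE => /eqP->; rewrite in_cons /rule_sentence catA mem_cat;
    move: Hc; rewrite in_cons => /orP[->|->]; rewrite ?orbT.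
have [HA' HB'] := (models_sub sub_ev HA, models_sub sub_ev HB).
have Hpos i : i < size tree_sg -> 0 < nth 0 tree_sg i by case: i => [|[|[|[|[|[|[|]]]]]]].
split; last by split; [apply: (@join_embedding R A B true) | apply: (@join_embedding R A B false)].
have Hpat c : c \in goal_clause n :: map rule_clause R -> models (join R A B) [:: c].
  move=> Hc; have HAc := models_sub (sub_pat _ Hc) HA.
  have HBc := models_sub (sub_pat _ Hc) HB; move: Hc HAc HBc.
  rewrite in_cons => /predU1P[->|/mapP[r Hr ->]] HAc HBc; apply: join_pat_clause => //.
  - by move=> p; rewrite inE => /eqP->; apply: subpats_refl.
  - by move=> t /(_ _ (mem_head _ _)); rewrite inst_pat_of_tree.
  - exact: rule_root_prems.
  - exact: rule_root_concl.
move=> c; rewrite in_cons /rule_sentence !mem_cat => /or4P[Hc|Hc|Hc|Hc].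
- by apply: (Hpat c); rewrite ?mem_head // in_cons Hc.
- exact: join_eq_clauses Hc.
- exact: join_val_clauses Hc.
- by apply: (Hpat c); rewrite ?mem_head // in_cons Hc orbT.
Qed.

(** * Two models without a joint embedding when the goal is derivable *)

Fixpoint tree_height (t : tree) : nat :=
  if t is Nd a b then (maxn (tree_height a) (tree_height b)).+1 else 0.

Fixpoint trees (N : nat) : seq tree :=
  Lf :: if N is N'.+1 then [seq Nd a b | a <- trees N', b <- trees N'] else [::].

Lemma mem_trees N t : tree_height t <= N -> t \in trees N.
Proof.
elim: N t => [|N IH] [|a b] //=.
rewrite ltnS geq_max => /andP[/IH Ha /IH Hb].
by rewrite in_cons; apply/orP; right; apply: allpairs_f.
Qed.

(** Bounding the instance of [rule_root] covers every node that the rule clause mentions, so all of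
    them exist in the finite tree structure. *)
Inductive bderivable (R : seq rule) (N : nat) : tree -> Prop :=
| bderivable_rule r s : r \in R -> tree_height (inst s (rule_root r)) <= N ->
    (forall p, p \in r.1 -> bderivable R N (inst s p)) -> bderivable R N (inst s r.2).

Lemma bderivable_leq R M N t : M <= N -> bderivable R M t -> bderivable R N t.
Proof.
move=> MN; elim=> {t} r s Hr Hh _ IH.
exact: bderivable_rule Hr (leq_trans Hh MN) IH.
Qed.

Lemma derivable_bounded R t : derivable R t -> exists N, bderivable R N t.
Proof.
elim=> {t} r s Hr _ IH.
have [N HN] : exists N, forall p, p \in r.1 -> bderivable R N (inst s p).
  elim: (r.1) IH => [|p ps IHps] IH; first by exists 0.
  have [M HM] := IH p (mem_head _ _).
  have [N HN] : exists N, forall p, p \in ps -> bderivable R N (inst s p).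
    by apply: IHps => q Hq; apply: IH; rewrite in_cons Hq orbT.
  exists (maxn M N) => q; rewrite in_cons => /predU1P[->|/HN].
    exact: bderivable_leq (leq_maxl _ _) HM.
  exact/bderivable_leq/leq_maxr.
exists (maxn N (tree_height (inst s (rule_root r)))); apply: (bderivable_rule Hr).
  exact: leq_maxr.
by move=> p /HN; apply/bderivable_leq/leq_maxl.
Qed.

Definition tree_rel (i : nat) (ts : seq tree) : bool :=
  match i, ts with
  | 0, [:: a] => a == Lf
  | 1, [:: a; b] => if a is Nd c _ then c == b else false
  | 2, [:: a; b] => if a is Nd _ c then c == b else false
  | 3, [:: a; b] => a == b
  | _, _ => false
  end.

Definition tree_structure (N : nat) : fstructure :=
  @FStructure (size (trees N)).-1
    (fun i t => tree_rel i [seq nth Lf (trees N) (val x) | x <- t]).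

(** [Q] holds here but there is no leaf, whereas the tree structure has leaves but no [Q]; hence
    [Val] can be empty in both. *)
Definition point_structure : fstructure :=
  @FStructure 0 (fun i _ => (i == 3) || (i == 4)).

(** The body of a pattern clause always contains a [Val] atom at its root. *)
Lemma sat_pat_clause_no_val (A : fstructure) nm ps root h :
  (forall x y, ~~ fs_rel A 5 [:: x; y]) -> sat_clause A (pat_clause nm ps root h).
Proof.
move=> HA s /=; rewrite all_cat => /andP[_ H].
have : holds_atom A s (aVal 0 (nm root)) by case: root H => [i||a b] /andP[].
by rewrite /holds_atom /= (negbTE (HA _ _)).
Qed.

Lemma models_no_val (A : fstructure) R n :
  (forall x y, ~~ fs_rel A 5 [:: x; y]) -> models A eq_clauses ->
  sat_clause A ([:: aQ 0; aLeaf 1], Some (aVal 0 1)) ->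
  models A (goal_clause n :: rule_sentence R).
Proof.
move=> HA He Hl c; rewrite in_cons /rule_sentence !mem_cat => /or4P[/eqP->|/He//| |/mapP[r _ ->]].
- exact: sat_pat_clause_no_val.
- rewrite !inE => /orP[]/eqP-> // s /and5P[_ _ H].
  by move: H; rewrite /holds_atom /= (negbTE (HA _ _)).
- exact: sat_pat_clause_no_val.
Qed.

Lemma models_tree_structure N R n :
  models (tree_structure N) (goal_clause n :: rule_sentence R).
Proof.
apply: models_no_val => //.
apply/forall_memP; do !split=> //; move=> s; rewrite /= /holds_atom /=.
- by rewrite eqxx.
- by case/and4P=> /eqP <-; case: (nth _ _ _) => //= a b /eqP-> /eqP->.
- by case/and4P=> /eqP <-; case: (nth _ _ _) => //= a b /eqP-> /eqP->.
- by case/and4P=> /eqP <- /eqP->.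
- by case/and4P=> /eqP <-; case: (nth _ _ _).
Qed.

Lemma models_point_structure R n :
  models point_structure (goal_clause n :: rule_sentence R).
Proof. by apply: models_no_val => //; apply/forall_memP; do !split. Qed.

Lemma pat_height_pnum n : pat_height (pnum n) = n.
Proof. by elim: n => //= n IH; rewrite max0n IH. Qed.

Lemma subpats_pnum n q : q \in subpats (pnum n) -> q = pnum (pat_height q).
Proof.
elim: n => [|n IH]; rewrite [subpats _]/= in_cons => /predU1P[->|] //.
  by rewrite -[PN _ _]/(pnum n.+1) pat_height_pnum.
by rewrite in_cons => /predU1P[->//|/IH].
Qed.

Section Refutation.
Context (R : seq rule) (N n : nat) (C : fstructure).
Context (HC : models C (goal_clause n :: rule_sentence R)).
Context (f : dom (tree_structure N) -> dom C).
Context (Hf : embedding tree_sg (tree_structure N) C f).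
Context (z : dom C) (Hz : fs_rel C 4 [:: z]).

(** The image in [C] of the element for [t]; [inord] is faithful for trees of height at most [N],
    whose index is in range. *)
Let elt (t : tree) : dom C := f (inord (index t (trees N))).

Let rel_elt i (ts : seq tree) : i < size tree_sg -> size ts = nth 0 tree_sg i ->
  all (fun t => tree_height t <= N) ts -> fs_rel C i (map elt ts) = tree_rel i ts.
Proof.
move=> Hi Hs /allP Hts.
have -> : map elt ts = map f (map (fun t => inord (index t (trees N))) ts).
  by rewrite -map_comp.
rewrite -(Hf.2 i Hi) ?size_map //=.
congr tree_rel; rewrite -map_comp -[RHS]map_id; apply/eq_in_map => t /Hts /mem_trees Ht.
have Hlt : index t (trees N) < size (trees N) by rewrite index_mem.
by rewrite /= inordK ?nth_index // prednK // (leq_ltn_trans _ Hlt).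
Qed.

(** Once [C] contains both a point with [Q] and the trees, [val_clauses] force [Val] by induction on
    the tree. *)
Let value_elt t : tree_height t <= N -> fs_rel C 5 [:: z; elt t].
Proof.
have Hval c s : c \in val_clauses -> all (holds_atom C s) c.1 ->
    if c.2 is Some a then holds_atom C s a else false.
  by move=> Hc; apply: HC; rewrite in_cons /rule_sentence !mem_cat Hc !orbT.
elim: t => [|a IHa b IHb] Ht.
  have := Hval _ (nth z [:: z; elt Lf]) (mem_head _ _).
  by rewrite /= /holds_atom /= Hz (@rel_elt 0 [:: Lf]) //; apply.
have := Ht; rewrite /= => /ltnW; rewrite geq_max => /andP[Ha Hb].
have := Hval _ (nth z [:: z; elt (Nd a b); elt a; elt b]) (mem_last _ _).
rewrite /= /holds_atom /= IHa // IHb //.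
rewrite (@rel_elt 1 [:: Nd a b; a]) ?(@rel_elt 2 [:: Nd a b; b]) //=.
- by rewrite !eqxx; apply.
- by rewrite Ht Hb.
- by rewrite Ht Ha.
Qed.

Let holds_pat_atoms nm (t : nat -> tree) (s : nat -> dom C) p :
  s 0 = z -> (forall q, q \in subpats p -> s (nm q) = elt (inst t q)) ->
  tree_height (inst t p) <= N -> all (holds_atom C s) (pat_atoms nm p).
Proof.
move=> s0; elim: p => [i||a IHa b IHb] Hs Hh.
- by rewrite /= /holds_atom /= s0 Hs ?value_elt // subpats_refl.
- rewrite /= /holds_atom /= s0 Hs ?value_elt ?subpats_refl //=.
  by rewrite (@rel_elt 0 [:: Lf]).
have Ha q : q \in subpats a -> q \in subpats (PN a b).
  by rewrite [in X in _ -> X]/= in_cons mem_cat => ->; rewrite orbT.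
have Hb q : q \in subpats b -> q \in subpats (PN a b).
  by rewrite [in X in _ -> X]/= in_cons mem_cat => ->; rewrite !orbT.
have := Hh; rewrite /= => /ltnW; rewrite geq_max => /andP[Hha Hhb].
rewrite all_cat IHa ?IHb //; first last.
- by move=> q /Ha; apply: Hs.
- by move=> q /Hb; apply: Hs.
have Hr := @subpats_refl.
rewrite /holds_atom /= s0 !(Hs _ (Hr _), Hs _ (Ha _ (Hr _)), Hs _ (Hb _ (Hr _))).
rewrite (value_elt Hh) (@rel_elt 1 [:: inst t (PN a b); inst t a]) //=.
  rewrite (@rel_elt 2 [:: inst t (PN a b); inst t b]) //= ?eqxx //.
  by rewrite Hhb Hh.
by rewrite Hha Hh.
Qed.

(** [dn] recovers a subpattern of [root] from its name, which turns the substitution [t] into an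
    assignment; nonzero names leave variable 0 for [z]. *)
Let apply_pat_clause nm dn (t : nat -> tree) ps root h :
  sat_clause C (pat_clause nm ps root h) ->
  (forall q, q \in subpats root -> nm q != 0 /\ dn (nm q) = q) ->
  {subset ps <= subpats root} -> (if h is Some p then p \in subpats root else true) ->
  tree_height (inst t root) <= N ->
  (forall p, p \in ps -> fs_rel C 6 [:: z; elt (inst t p)]) ->
  if h is Some p then fs_rel C 6 [:: z; elt (inst t p)] else false.
Proof.
move=> Hc Hn Hps Hh HN Hder.
pose s k := if k == 0 then z else elt (inst t (dn k)).
have Hs q : q \in subpats root -> s (nm q) = elt (inst t q).
  by move=> /Hn[/negbTE H E]; rewrite /s H E.
have := Hc s; rewrite /= all_cat (holds_pat_atoms _ Hs) // andbT all_map.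
have -> : all (preim (fun p => aDer 0 (nm p)) (holds_atom C s)) ps.
  by apply/allP=> p Hp; rewrite /= /holds_atom /= Hs ?Hps //; apply: Hder.
move/(_ isT); case: h Hh {Hc} => //= p Hp.
by rewrite /holds_atom /= Hs.
Qed.

Lemma bderivable_elt t : bderivable R N t -> fs_rel C 6 [:: z; elt t].
Proof.
elim=> {t} r t Hr Hh _ IH.
apply: (@apply_pat_clause pat_name (fun k => odflt PL (unpickle k.-1)) t
  r.1 (rule_root r) (Some r.2)).
- by apply: HC; rewrite in_cons /rule_sentence !mem_cat (map_f rule_clause Hr) !orbT.
- by move=> q _; rewrite /pat_name /= pickleK.
- exact: rule_root_prems.
- exact: rule_root_concl.
- exact: Hh.
- exact: IH.
Qed.

Lemma not_bderivable_goal : n <= N -> ~ bderivable R N (num n).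
Proof.
move=> nN /bderivable_elt H.
suff : false by [].
(* A subpattern of [pnum n] is the numeral of its own height, so [pnum k.-1] inverts [num_name]. *)
apply: (@apply_pat_clause num_name (fun k => pnum k.-1) (fun=> Lf) [:: pnum n] (pnum n) None).
- by apply: HC; apply: mem_head.
- by move=> q /subpats_pnum E; rewrite /num_name /= -E.
- by move=> p; rewrite inE => /eqP->; apply: subpats_refl.
- by [].
- rewrite inst_pat_of_tree; apply: (leq_trans _ nN).
  by elim: (n) => //= m; rewrite max0n ltnS.
- by move=> p; rewrite inE => /eqP->; rewrite inst_pat_of_tree.
Qed.
End Refutation.

Lemma JEP_derivableP R n :
  JEP tree_sg (goal_clause n :: rule_sentence R) <-> ~ derivable R (num n).
Proof.
split; last exact: JEP_of_not_derivable.
move=> HJ /derivable_bounded[N HN].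
(* [N] accommodates the derivation and [n] the numeral in the goal clause. *)
have [C [HC [[f Hf] [g Hg]]]] :=
  HJ _ _ (@models_tree_structure (maxn N n) R n) (@models_point_structure R n).
apply: (@not_bderivable_goal R (maxn N n) n C HC f Hf (g ord0)).
- by have := Hg.2 4 isT [:: ord0] erefl.
- exact: leq_maxr.
- exact: bderivable_leq (leq_maxl _ _) HN.
Qed.

(** * Computing the code of the input *)

Lemma pat_atoms_pnumS k : pat_atoms num_name (pnum k.+1) =
  [:: aVal 0 k.+2, aFst k.+2 1, aSnd k.+2 k.+1, aVal 0 1, aLeaf 1 &
      pat_atoms num_name (pnum k)].
Proof. by rewrite /pnum /= /num_name /= max0n pat_height_pnum. Qed.

(** Follows [pat_atoms_pnumS]: in the recursive step [RProj 0] is k, so [x] is the name k + 2 of the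
    root, and [RProj 1] is the code of the atoms for k. *)
Definition rgoal_atoms : recf :=
  let x := rsucc (rsucc (RProj 0)) in
  let one := rconst 1 in
  let leaf_atoms f := rcons_code (ratom 5 [:: RZero; one]) (rcons_code (ratom 0 [:: one]) f) in
  RRec (leaf_atoms RZero)
    (rcons_code (ratom 5 [:: RZero; x])
      (rcons_code (ratom 1 [:: x; one])
        (rcons_code (ratom 2 [:: x; rsucc (RProj 0)]) (leaf_atoms (RProj 1))))).

Lemma rgoal_atomsP n :
  reval rgoal_atoms [:: n] (enc_seq enc_atom (pat_atoms num_name (pnum n))).
Proof.
have RZ v : reval RZero v 0 by apply: ev_zero.
have R1 v : reval (rconst 1) v 1 by apply: rconstP.
have leafP f v s : reval f v (enc_seq enc_atom s) ->
    reval (rcons_code (ratom 5 [:: RZero; rconst 1]) (rcons_code (ratom 0 [:: rconst 1]) f)) v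
      (enc_seq enc_atom [:: aVal 0 1, aLeaf 1 & s]).
  move=> Hf; do 2![apply: rcons_codeP;
    first by apply: ratomP; do ![apply: Forall2_cons => //]; apply: Forall2_nil].
  exact: Hf.
elim: n => [|n IH]; first exact/ev_rec0/(@leafP _ _ [::])/RZ.
rewrite pat_atoms_pnumS; apply: ev_recS IH _.
have Rx v : reval (rsucc (RProj 0)) (n :: v) n.+1 by exact/rsuccP/(ev_proj 0).
have Rxx v : reval (rsucc (rsucc (RProj 0))) (n :: v) n.+2 by exact/rsuccP/Rx.
do 3![apply: rcons_codeP;
  first by apply: ratomP; do ![apply: Forall2_cons => //]; apply: Forall2_nil].
exact/leafP/(ev_proj 1).
Qed.

Lemma rseq_constP s v : reval (rseq (map rconst s)) v (enc_seq id s).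
Proof.
elim: s => [|k s IH]; first exact: ev_zero.
exact: (@rcons_codeP _ id _ _ _ k _ (rconstP k v)).
Qed.

Definition rinput_code (x m : recf) : recf :=
  rpair (rseq (map rconst tree_sg))
    (rcons_code
      (rpair (rcons_code (ratom 6 [:: RZero; rsucc x]) (RComp rgoal_atoms [:: x])) RZero) m).

Lemma rinput_codeP x m v n phi :
  reval x v n -> reval m v (enc_seq enc_clause phi) ->
  reval (rinput_code x m) v (enc_input (tree_sg, goal_clause n :: phi)).
Proof.
move=> Hx Hm; apply: (rpairP (rseq_constP tree_sg v)).
apply: rcons_codeP Hm; apply: rpairP (ev_zero _).
rewrite /= {1}/num_name pat_height_pnum; apply: (@rcons_codeP _ enc_atom _ _ _ (aDer 0 n.+1)).
  by apply: ratomP; apply: Forall2_cons (ev_zero _) _; apply/Forall2_cons/Forall2_nil/rsuccP.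
exact: reval_comp1 Hx (rgoal_atomsP n).
Qed.

(** * Diagonalisation *)

Lemma JEP_undecidable : undecidable enc_input valid_input_arity2 JEP_problem.
Proof.
case=> p Hp.
(* Argument 0 is the search variable, which is ignored; [RProj 1] is the input. The successor
   matches [derivable_haltP], where halting on m is derivability of [num m.+1]. *)
pose q := RComp p [:: rinput_code (rsucc (RProj 1)) (RProj 1)].
(* The search stops at 0 if [q] returns 1 and never stops if [q] returns 0. *)
pose d := RMu (RComp rnot [:: q]).
pose phi := rule_sentence (rules d); pose m := enc_seq enc_clause phi.
pose x := (tree_sg, goal_clause m.+1 :: phi).
have Hx : valid_input_arity2 x by split; first exact: wf_goal_rules.
have JEP_haltP : JEP_problem x <-> ~ exists y, reval d [:: m] y.
  by rewrite /JEP_problem JEP_derivableP derivable_haltP.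
have Hq y b : reval p [:: enc_input x] b -> reval q [:: y; m] b.
  apply: reval_comp1; apply: rinput_codeP; first exact/rsuccP/(ev_proj 1).
  exact: (ev_proj 1).
(* If [p] accepts [x], then [d] halts on [m], which refutes JEP; if [p] rejects, a halting [d] would
   make [rnot] of 0 both 0 and 1, so JEP holds after all. *)
case: (Hp x Hx) => -[HJ Hb].
  apply: (JEP_haltP.1 HJ); exists 0; apply: ev_mu => //.
  exact: reval_comp1 (Hq 0 _ Hb) rnot1.
apply: HJ; apply/JEP_haltP => -[y Hy]; inversion Hy as [| | | | | |f v n H0 _]; subst.
by have := reval_det H0 (reval_comp1 (Hq y _ Hb) rnot0).
Qed.

Theorem theorem3 :
  undecidable enc_input valid_input JEP_problem /\
  undecidable enc_input valid_input_arity2 JEP_problem.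
Proof.
split; last exact: JEP_undecidable.
case=> p Hp; apply: JEP_undecidable; exists p => x [Hx _]; exact: Hp.
Qed.
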